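(* Let $T$ be a simply connected immersed triangulation in the plane with edge set $E$, and let $\vartheta\in[0,\pi/2]$. The 1-form $$\Xi_\vartheta(\omega)=\sum_{e=[v_i,v_j]\in E_{int}}\big(\nu_{il}^{\Delta_{ilj}}-\nu_{lj}^{\Delta_{ilj}}+\nu_{jk}^{\Delta_{ijk}}-\nu_{ki}^{\Delta_{ijk}}\big)\,d\omega_e,$$ defined in a neighborhood of a solution (values $\omega\in\mathbb{R}^{|E|}$ which give rise to a discrete $\vartheta$-conformal map), is closed.
   Context: Triangulation: $T$ is a (locally) embedded, i.e. immersed, non-degenerate triangulation in the plane $\mathbb{C}$ with vertices $v_i\in\mathbb{C}$, edges $e=[v_i,v_j]\in E$, interior edges $E_{int}$ (those contained in two triangles), and triangles $\Delta[v_i,v_j,v_k]$ with vertices listed counterclockwise. An interior vertex together with its incident triangles is a flower. Write $w_{ij}=v_j-v_i$, and let $\alpha_k^{\Delta[v_i,v_j,v_k]}\in(0,\pi)$ be the angle at $v_k$. Discrete immersion: a map $F:T\to\mathbb{C}$ which is continuous, affine-linear on every triangle and orientation preserving, such that for every flower all pairs of image triangles intersect only in their common vertex or edge. Write $z_i=F(v_i)$ and $z_{ij}=z_j-z_i$. Cross-ratios: $\mathrm{cr}(z_1,z_2,z_3,z_4)=\frac{(z_1-z_2)(z_3-z_4)}{(z_2-z_3)(z_4-z_1)}$. For an interior edge $[v_i,v_j]$ with adjacent triangles $\Delta[v_i,v_j,v_k]$ and $\Delta[v_i,v_l,v_j]$ put $Q([v_i,v_j])=\mathrm{cr}(v_i,v_l,v_j,v_k)$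 and $q([v_i,v_j])=\mathrm{cr}(z_i,z_l,z_j,z_k)$. Discrete $\vartheta$-conformal map: a discrete immersion $F$ with $\mathrm{Re}[e^{-i\vartheta}\log Q(e)]=\mathrm{Re}[e^{-i\vartheta}\log q(e)]$ for every interior edge $e$, where the logarithms take values in $\mathbb{R}+i(0,2\pi)$. Variables: for a discrete immersion $F$, real numbers $\omega_{ij},\nu_{ij}$ on the edges are given by $z_{ij}=w_{ij}\exp(e^{i\vartheta}(i\omega_{ij}+\nu_{ij}))$, chosen such that in every triangle $\Delta[v_i,v_j,v_k]$ the angle of the image triangle at $z_k$ equals $\alpha_k^{\Delta[v_i,v_j,v_k]}+\cos\vartheta(\omega_{jk}-\omega_{ki})+\sin\vartheta(\nu_{jk}-\nu_{ki})$, and cyclically. The $\omega$'s are the free variables, collected in a vector $\omega\in\mathbb{R}^{|E|}$ with entries $\omega_e$. In each triangle $\Delta=\Delta[v_i,v_j,v_k]$ the $\nu$'s are regarded as dependent real functions $\nu^\Delta(\omega)$ determined, up to a common additive constant in $\Delta$, by the closing condition $$w_{ij}\exp(e^{i\vartheta}(i\omega_{ij}+\nu^\Delta_{ij}))+w_{jk}\exp(e^{i\vartheta}(i\omega_{jk}+\nu^\Delta_{jk}))+w_{ki}\exp(e^{i\vartheta}(i\omega_{ki}+\nu^\Delta_{ki}))=0.$$ The variables $\omega$ vary within a neighborhood of the solution, so that the $\nu^\Delta(\omega)$ are well defined (up to these constants) and smooth. The two values of $\nu$ on one edge coming from its two triangles will in general be different. In the 1-form $\Xi_\vartheta$ the sum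 is over all interior edges $e=[v_i,v_j]$, contained in the two counterclockwise triangles $\Delta_{ilj}=\Delta[v_i,v_l,v_j]$ and $\Delta_{ijk}=\Delta[v_i,v_j,v_k]$.
   Formalization: Closedness is claimed in the interior-edge variables only, with the boundary values of ω held fixed as parameters; as a 1-form on an open set of all of R^{|E|} the form is not closed (e.g. two equilateral triangles sharing an edge). *)

(* Defs.v *)
From HB Require Import structures.
From mathcomp Require Import all_boot all_order all_algebra.
From mathcomp Require Import complex.
From mathcomp Require Import all_classical all_reals all_analysis.

Set Implicit Arguments.
Unset Strict Implicit.
Unset Printing Implicit Defensive.
Import Order.TTheory GRing.Theory Num.Theory.
Import numFieldNormedType.Exports.

Local Open Scope classical_set_scope.
Local Open Scope ring_scope.
Local Open Scope complex_scope.

Section PlaneGeometry.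
Context {R : realType}.
Implicit Types a b c d z : R[i].

Definition Cexp z : R[i] :=
  (expR (complex.Re z))%:C * (cos (complex.Im z) +i* sin (complex.Im z)).

(* The branch of the logarithm on C \ [0, +oo[ with values in R + i(0, 2 pi). *)
Definition Carg z : R :=
  let phi := acos (complex.Re z / Normc.normc z) in
  if 0 <= complex.Im z then phi else 2 * pi - phi.

Definition Clog z : R[i] := ln (Normc.normc z) +i* Carg z.

(* Twice the signed area of the triangle a, b, c: it is positive iff the
   vertices are listed counterclockwise, and zero iff they are collinear. *)
Definition area2 a b c : R := complex.Im ((b - a)^* * (c - a)).

(* The unoriented angle at b of the triangle a, b, c. *)
Definition angle a b c : R :=
  acos (complex.Re ((a - b)^* * (c - b)) /
        (Normc.normc (a - b) * Normc.normc (c - b))).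

Definition cross_ratio a b c d : R[i] :=
  ((a - b) * (c - d)) / ((b - c) * (d - a)).

End PlaneGeometry.

Section Topology.
Context {R : realType} {n : nat}.
Implicit Type X : set 'rV[R]_n.

Definition path_connected X : Prop :=
  X !=set0 /\
  forall x y, X x -> X y -> exists g : R -> 'rV[R]_n,
    [/\ {within `[0, 1], continuous g}, forall t, t \in `[0, 1] -> X (g t),
        g 0 = x & g 1 = y].

Definition simply_connected X : Prop :=
  path_connected X /\
  forall g : R -> 'rV[R]_n,
    {within `[0, 1], continuous g} ->
    (forall t, t \in `[0, 1] -> X (g t)) -> g 0 = g 1 ->
    exists H : R * R -> 'rV[R]_n,
      [/\ {within `[0, 1] `*` `[0, 1], continuous H},
          forall s t, s \in `[0, 1] -> t \in `[0, 1] -> X (H (s, t)),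
          forall t, t \in `[0, 1] -> H (0, t) = g t,
          forall t, t \in `[0, 1] -> H (1, t) = g 0 &
          forall s, s \in `[0, 1] -> H (s, 0) = g 0 /\ H (s, 1) = g 0].

End Topology.

Section Calculus.
Context {R : realType} {n : nat}.

Fixpoint Cn (m : nat) (U : set 'rV[R]_n) (f : 'rV[R]_n -> R) : Prop :=
  if m is m'.+1 then
    (forall x, U x -> differentiable f x) /\
    (forall a, Cn m' U (fun x => 'D_a f x))
  else forall x, U x -> {for x, continuous f}.

Definition smooth_on (U : set 'rV[R]_n) (f : 'rV[R]_n -> R) : Prop :=
  forall m, Cn m U f.

(* A 1-form Xi is encoded by (x, a) |-> Xi_x(a).  Its exterior derivative is
   dXi_x(a, b) = D_a (Xi(b)) (x) - D_b (Xi(a)) (x) for constant fields a, b.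
   When W is a linear subspace, closed_along U W Xi says that on the open set
   U the restriction of Xi to every slice U /\ (x0 + W) is closed. *)
Definition closed_along (U W : set 'rV[R]_n)
    (Xi : 'rV[R]_n -> 'rV[R]_n -> R) : Prop :=
  forall x, U x ->
    (forall a, differentiable (fun y => Xi y a) x) /\
    (forall a b, W a -> W b ->
      'D_a (fun y => Xi y b) x = 'D_b (fun y => Xi y a) x).

End Calculus.

Local Close Scope classical_set_scope.

(* A finite simplicial surface is given by its set T of triangles, which are
   three-element subsets of V; its position in the plane is given by the vertex
   positions v : V -> C. *)
Section Triangulation.
Context {R : realType} {V : finType}.
Implicit Types (T : {set {set V}}) (p v z : V -> R[i]).

(* Barycentric coordinates: the point \sum_i x_i i of the full simplex on V. *)
Definition face (s : {set V}) : set 'rV[R]_#|V| :=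
  [set x | [/\ forall i, 0 <= x 0 (enum_rank i),
               forall i, i \notin s -> x 0 (enum_rank i) = 0 &
               \sum_i x 0 (enum_rank i) = 1]]%classic.

Definition realization T : set 'rV[R]_#|V| :=
  [set x | exists2 t, t \in T & face t x]%classic.

(* The map on the realization which is affine on every triangle and takes the
   values p at the vertices.  A continuous map which is affine-linear on every
   triangle is of this form for exactly one p, so it is represented by p. *)
Definition pl p (x : 'rV[R]_#|V|) : R[i] :=
  \sum_i (x 0 (enum_rank i))%:C * p i.

Definition edges T : {set {set V}} :=
  [set e : {set V} | (#|e| == 2) && [exists t in T, e \subset t]].

Definition interior_edges T : {set {set V}} :=
  [set e in edges T | #|[set t in T | e \subset t]| == 2].

Definition interior_vertex T (x : V) : bool :=
  [forall e in edges T, (x \in e) ==> (e \in interior_edges T)].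

Definition star_embedded T p (x : V) : Prop :=
  forall t t', t \in T -> t' \in T -> x \in t -> x \in t' -> t != t' ->
    ((pl p @` face t) `&` (pl p @` face t') `<=` pl p @` face (t :&: t')%SET)%classic.

(* The third clause says that vertex links are connected; that every edge lies
   in at most two triangles follows from the last one.  The last two clauses
   say that pl v is injective near every point, i.e. an immersion. *)
Definition immersed_triangulation T v : Prop :=
  [/\ forall t, t \in T -> #|t| = 3,
      forall x, exists2 t, t \in T & x \in t,
      forall x t t', t \in T -> t' \in T -> x \in t -> x \in t' ->
        connect [rel s s' : {set V} | [&& s \in T, s' \in T, x \in s, x \in s' &
                                          #|s :&: s'| == 2]] t t',
      forall i j k, [set i; j; k] \in T -> i != j -> j != k -> k != i ->
        area2 (v i) (v j) (v k) != 0 &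
      forall x, star_embedded T v x].

(* Delta[v_i, v_j, v_k] is a triangle of T with vertices listed
   counterclockwise. *)
Definition ccw_triangle T v (i j k : V) : bool :=
  ([set i; j; k] \in T) && (0 < area2 (v i) (v j) (v k)).

Definition discrete_immersion T v z : Prop :=
  (forall i j k, ccw_triangle T v i j k -> 0 < area2 (z i) (z j) (z k)) /\
  (forall x, interior_vertex T x -> star_embedded T z x).

Definition theta_conformal T v (theta : R) z : Prop :=
  discrete_immersion T v z /\
  forall i j k l, ccw_triangle T v i j k -> ccw_triangle T v i l j ->
    complex.Re (Cexp (- (theta *i)) *
                Clog (cross_ratio (v i) (v l) (v j) (v k))) =
    complex.Re (Cexp (- (theta *i)) *
                Clog (cross_ratio (z i) (z l) (z j) (z k))).

Definition edge_type T : finType := {e : {set V} | e \in edges T}.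

(* R^|E|, with the entry of omega at the edge e (and 0 if e is not an edge). *)
Definition edge_space T := 'rV[R]_#|edge_type T|.

Definition entry T (omega : edge_space T) (e : {set V}) : R :=
  if insub e is Some e' then omega 0 (enum_rank (e' : edge_type T)) else 0.

(* exp (e^(i theta) (i a + b)) *)
Definition twist (theta a b : R) : R[i] :=
  Cexp (Cexp (theta *i) * (b +i* a)).

(* omega and nu are the variables of the discrete immersion z. *)
Definition edge_variables T v (theta : R) z (omega nu : edge_space T) : Prop :=
  (forall i j, [set i; j] \in edges T ->
     z j - z i = (v j - v i) *
       twist theta (entry omega [set i; j]) (entry nu [set i; j])) /\
  (forall i j k, ccw_triangle T v i j k ->
     angle (z j) (z k) (z i) = angle (v j) (v k) (v i)
       + cos theta * (entry omega [set j; k] - entry omega [set k; i])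
       + sin theta * (entry nu [set j; k] - entry nu [set k; i])).

(* nu t e omega is the value nu_e^t(omega) for an edge e of the triangle t. *)
Definition closing_condition T v (theta : R) (U : set (edge_space T))
    (nu : {set V} -> {set V} -> edge_space T -> R) : Prop :=
  forall omega, U omega -> forall i j k, ccw_triangle T v i j k ->
    let t := [set i; j; k] in
    let summand a b := (v b - v a) *
      twist theta (entry omega [set a; b]) (nu t [set a; b] omega) in
    summand i j + summand j k + summand k i = 0.

(* The functions nu^Delta on the open neighbourhood U of omega0: smooth
   solutions of the closing condition which at omega0 agree with nu0 up to a
   common additive constant in each triangle. *)
Definition dependent_nu T v (theta : R) (U : set (edge_space T))
    (omega0 nu0 : edge_space T)
    (nu : {set V} -> {set V} -> edge_space T -> R) : Prop :=
  [/\ forall t e, t \in T -> e \in edges T -> e \subset t ->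
        smooth_on U (nu t e),
      forall t, t \in T -> exists c : R, forall e,
        e \in edges T -> e \subset t -> nu t e omega0 = entry nu0 e + c &
      closing_condition v theta U nu].

(* Labels (i, j, k, l) with e = [v_i, v_j] contained in the triangles
   Delta[v_i, v_j, v_k] and Delta[v_i, v_l, v_j].  For an interior edge there
   are two of them, exchanged by i <-> j, k <-> l; xi_coef does not depend on
   which one is picked. *)
Definition edge_labels T v (e : {set V}) : option (V * V * V * V) :=
  [pick q : V * V * V * V | let: (i, j, k, l) := q in
    [&& e == [set i; j], ccw_triangle T v i j k & ccw_triangle T v i l j]].

Definition xi_coef T v (nu : {set V} -> {set V} -> edge_space T -> R)
    (e : {set V}) (omega : edge_space T) : R :=
  if edge_labels T v e is Some (i, j, k, l) then
    nu [set i; l; j] [set i; l] omega - nu [set i; l; j] [set l; j] omega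
    + nu [set i; j; k] [set j; k] omega - nu [set i; j; k] [set k; i] omega
  else 0.

Definition Xi T v (nu : {set V} -> {set V} -> edge_space T -> R)
    (omega a : edge_space T) : R :=
  \sum_(e in interior_edges T) xi_coef v nu e omega * entry a e.

(* Xi only involves d omega_e for interior e, but its coefficients also depend
   on the omega_e of the boundary edges of T, and Xi is in general not closed
   with respect to those: they are parameters, kept at prescribed values.
   These are the directions which leave them unchanged. *)
Definition interior_directions T : set (edge_space T) :=
  [set a | forall e, e \in edges T -> e \notin interior_edges T ->
             entry a e = 0]%classic.

End Triangulation.

(* Main.v *)
Require Import Defs.
From HB Require Import structures.
From mathcomp Require Import all_boot all_order all_algebra.
From mathcomp Require Import complex.
From mathcomp Require Import all_classical all_reals all_analysis.
From mathcomp Require Import ring lra.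
Set Implicit Arguments.
Unset Strict Implicit.
Unset Printing Implicit Defensive.
Import Order.TTheory GRing.Theory Num.Theory.
Import numFieldNormedType.Exports.
Local Open Scope ring_scope.

(** The 1-form is a sum of closed 1-forms, one for each triangle.

    An edge e = [v_i, v_j] of a counterclockwise triangle (i, j, k) is opposite
    to the corner k, and this triangle contributes nu_jk - nu_ki to the
    coefficient of d omega_e ([opp_coef]).  The two triangles at an interior
    edge lie on different sides of it and so induce opposite orientations on
    it, which makes the coefficient of Xi the sum of their two contributions
    ([xi_coef_sum]).  That they lie on different sides is where the immersion
    enters: two triangles on the same side of a common edge overlap near its
    midpoint ([star_opposite]).  A direction which fixes the boundary entries
    does not see the boundary edges, so along such directions Xi is the sum
    over all triangles of
      (nu_jk - nu_ki) d omega_ij + (nu_ki - nu_ij) d omega_jk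
        + (nu_ij - nu_jk) d omega_ki.

    To see that one such form is closed, write the closing condition as
    A + B + C = 0 and differentiate it in a direction a.  The common factor
    e^(i theta) cancels and leaves A mu_ij + B mu_jk + C mu_ki = 0 for the
    complex numbers mu = D_a nu + i a ([closing_derivative]).  Eliminating C,
    the differences p(a) = mu_ij - mu_ki and q(a) = mu_jk - mu_ki satisfy
    A p(a) = - B q(a): their ratio does not depend on a.  Hence
    p(a) q(b) = p(b) q(a), and the imaginary part of this equation is the
    symmetry of the derivative of the form ([closing_symmetric]). *)

(** * Calculus along lines *)

Section Calculus.
Variable R : realType.
Local Open Scope complex_scope.

(** Reduces directional derivatives to derivatives in one real variable, where
    the chain rule is available. *)
Lemma is_derive_line n (f : 'rV[R]_n -> R) (x a : 'rV[R]_n) :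
  derivable f x a ->
  is_derive (0 : R) 1 (fun h => f (h *: a + x)) ('D_a f x).
Proof.
pose q h := h^-1 *: ((f \o shift x) (h *: a) - f x).
have e : (fun h => h^-1 *: (((fun h => f (h *: a + x)) \o shift 0) (h *: 1) -
    (fun h => f (h *: a + x)) 0)) = q.
  by apply/funext => h; rewrite /q /= addr0 scale0r add0r /GRing.scale /= mulr1.
move=> Df; split; first by rewrite /derivable e.
by rewrite /derive e.
Qed.

Lemma is_derive_near0 (f : R -> R) (t d : R) :
  is_derive t 1 f d -> (\forall s \near t, f s = 0)%classic -> d = 0.
Proof.
move=> [_ <-] f0; rewrite -(derive_cst (0 : R) t (1 : R)).
exact: near_eq_derive.
Qed.

Lemma is_derive_bigsum (W : normedModType R) (I : Type) (r : seq I)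
    (P : pred I) (f : I -> W -> R) (df : I -> R) (x a : W) :
  (forall i, P i -> is_derive x a (f i) (df i)) ->
  is_derive x a (fun y => \sum_(i <- r | P i) f i y) (\sum_(i <- r | P i) df i).
Proof.
move=> D; elim: r => [|i r IH].
  under eq_fun do rewrite big_nil.
  by rewrite big_nil; exact: is_derive_cst.
under eq_fun do rewrite big_cons.
rewrite big_cons; case Pi: (P i) => //.
by apply: is_deriveD => //; exact: D.
Qed.

Lemma differentiable_bigsum (W : normedModType R) (I : Type)
    (r : seq I) (P : pred I) (f : I -> W -> R) (x : W) :
  (forall i, P i -> differentiable (f i) x) ->
  differentiable (fun y => \sum_(i <- r | P i) f i y) x.
Proof.
move=> D; elim: r => [|i r IH].
  under eq_fun do rewrite big_nil.
  exact: differentiable_cst.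
under eq_fun do rewrite big_cons.
case Pi: (P i) => //.
by apply: differentiableD => //; exact: D.
Qed.

(** This is exp' = exp, multiplied by w; real and imaginary parts are
    differentiated separately because the variable is real. *)
Lemma is_derive_Cexp (w : R[i]) (f g : R -> R) (t df dg : R) :
  is_derive t 1 f df -> is_derive t 1 g dg ->
  let d := w * Cexp (f t +i* g t) * (df +i* dg) in
  is_derive t 1 (fun s => complex.Re (w * Cexp (f s +i* g s))) (complex.Re d) /\
  is_derive t 1 (fun s => complex.Im (w * Cexp (f s +i* g s))) (complex.Im d).
Proof.
move=> Df Dg.
have De := is_derive1_comp (is_derive_expR _) Df.
have Dc := is_derive1_comp (is_derive_cos _) Dg.
have Ds := is_derive1_comp (is_derive_sin _) Dg.
case: w => w1 w2; rewrite /Cexp /=; split.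
  by apply: is_derive_eq; rewrite /GRing.scale /=; ring.
by apply: is_derive_eq; rewrite /GRing.scale /=; ring.
Qed.

Lemma Cexp_neq0 (z : R[i]) : Cexp z != 0.
Proof.
apply/eqP => /(congr1 (fun y => complex.Re y ^+ 2 + complex.Im y ^+ 2)).
have := expR_gt0 (complex.Re z); rewrite /Cexp /=; move: (expR _) => e e0.
move: (cos2Dsin2 (complex.Im z)); move: (cos _) (sin _) => c s cs.
have -> : (e * c - 0 * s) ^+ 2 + (e * s + 0 * c) ^+ 2 = e ^+ 2 * (c ^+ 2 + s ^+ 2).
  by ring.
by rewrite cs mulr1 expr0n /= addr0 => /eqP; rewrite sqrf_eq0 gt_eqF.
Qed.

(** The factor [Cexp (theta *i)] comes first because it is the one which is
    common to the three sides of a triangle. *)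
Lemma is_derive_twist (w : R[i]) (theta : R) (f g : R -> R) (t df dg : R) :
  is_derive t 1 f df -> is_derive t 1 g dg ->
  let d := Cexp (theta *i) * (w * twist theta (g t) (f t) * (df +i* dg)) in
  is_derive t 1 (fun s => complex.Re (w * twist theta (g s) (f s))) (complex.Re d) /\
  is_derive t 1 (fun s => complex.Im (w * twist theta (g s) (f s))) (complex.Im d).
Proof.
move=> Df Dg; rewrite /twist mulrCA.
case: (Cexp (theta *i)) => c s.
have eu h k : (c +i* s) * (h +i* k) = (c * h - s * k) +i* (c * k + s * h) by simpc.
have Du : is_derive t 1 (fun r => c * f r - s * g r) (c * df - s * dg).
  by apply: is_derive_eq; rewrite /GRing.scale /=; ring.
have Dp : is_derive t 1 (fun r => c * g r + s * f r) (c * dg + s * df).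
  by apply: is_derive_eq; rewrite /GRing.scale /=; ring.
have [DR DI] := is_derive_Cexp w Du Dp.
under [X in is_derive _ _ X (complex.Re _)]eq_fun do rewrite eu.
under [X in is_derive _ _ X (complex.Im _)]eq_fun do rewrite eu.
by rewrite !eu.
Qed.

End Calculus.

(** * Triangles on the same side of an edge *)

Section Overlap.
Local Open Scope complex_scope.
Variable R : realType.
Implicit Types a b c d : R[i].

Lemma area2E a b c : area2 a b c =
  (complex.Re b - complex.Re a) * (complex.Im c - complex.Im a)
  - (complex.Im b - complex.Im a) * (complex.Re c - complex.Re a).
Proof.
by case: a b c => [? ?] [? ?] [? ?]; rewrite /area2 /=; simpc => /=; ring.
Qed.

(** Points close to the midpoint of [a, b], on the side of c and d, belong to
    both triangles.  Equal heights over [a, b] force the weights r and r' of c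
    and d to be inversely proportional to the areas A and A'; what then remains
    of the difference is parallel to b - a, and is absorbed by changing the
    weights of a and b by h * g, which is small with h. *)
Lemma same_side_overlap a b c d : 0 < area2 a b c -> 0 < area2 a b d ->
  exists s : R * R * R * (R * R * R),
  let: ((p, q, r), (p', q', r')) := s in
  [/\ [/\ 0 <= p, 0 <= q, 0 < r & p + q + r = 1],
      [/\ 0 <= p', 0 <= q', 0 < r' & p' + q' + r' = 1] &
      p%:C * a + q%:C * b + r%:C * c = p'%:C * a + q'%:C * b + r'%:C * d].
Proof.
case: a b c d => [ax ay] [bx by'] [cx cy] [dx dy]; rewrite !area2E /=.
set A := (X in 0 < X -> _); set A' := (X in _ -> 0 < X -> _) => A0 A'0.
pose wx := bx - ax; pose wy := by' - ay.
pose ux := A' * (cx - ax) - A * (dx - ax).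
pose uy := A' * (cy - ay) - A * (dy - ay).
(* (ux, uy) = A' (c - a) - A (d - a) is parallel to b - a = (wx, wy). *)
have par : wx * uy - wy * ux = 0.
  by rewrite /wx /wy /ux /uy /A /A'; ring.
pose n := wx ^+ 2 + wy ^+ 2.
have n0 : n != 0.
  apply: contraTneq A0 => /eqP; rewrite /n paddr_eq0 ?sqr_ge0 // !sqrf_eq0.
  by case/andP=> /eqP wx0 /eqP wy0; rewrite /A -/wx -/wy wx0 wy0 !mul0r subrr ltxx.
pose g := (wx * ux + wy * uy) / n.
have ugx : ux = g * wx.
  have : n * ux = (wx * ux + wy * uy) * wx.
    by apply: subr0_eq; rewrite -(mulr0 (- wy)) -par /n; ring.
  by move=> e; rewrite /g mulrAC -e mulrC mulKf.
have ugy : uy = g * wy.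
  have : n * uy = (wx * ux + wy * uy) * wy.
    by apply: subr0_eq; rewrite -(mulr0 wx) -par /n; ring.
  by move=> e; rewrite /g mulrAC -e mulrC mulKf.
(* With h = 1 / M all weights stay within 1/4 of their limits for h = 0, which
   are 1/2 at a and b, and 0 at c and d. *)
pose M := 4 * (1 + A + A' + `|g|).
have M0 : 0 < M by rewrite /M; have := normr_ge0 g; lra.
pose h := M^-1.
have h0 : 0 < h by rewrite invr_gt0.
have hM : h * M = 1 by rewrite mulVf // gt_eqF.
have hA : 0 < h * A by rewrite mulr_gt0.
have hA' : 0 < h * A' by rewrite mulr_gt0.
have hM4 : 4 * h + 4 * (h * A) + 4 * (h * A') + 4 * (h * `|g|) = 1.
  by rewrite -[RHS]hM /M; ring.
have hg1 : h * g <= h * `|g| by rewrite ler_pM2l // ler_norm.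
have hg2 : - (h * g) <= h * `|g| by rewrite -mulrN ler_pM2l // -normrN ler_norm.
pose r := h * A'; pose q := (1 - r) / 2; pose r' := h * A; pose q' := q + h * g.
exists ((1 - q - r, q, r), (1 - q' - r', q', r')); split.
- by rewrite /q /r; split; lra.
- by rewrite /q' /q /r /r'; split; lra.
- have ex : r * (cx - ax) - r' * (dx - ax) = h * g * wx.
    by rewrite -mulrA -ugx /ux /r /r'; ring.
  have ey : r * (cy - ay) - r' * (dy - ay) = h * g * wy.
    by rewrite -mulrA -ugy /uy /r /r'; ring.
  apply/eqP; rewrite eq_complex; apply/andP; split; apply/eqP.
    by simpc => /=; rewrite /wx in ex; rewrite /q'; nra.
  by simpc => /=; rewrite /wy in ey; rewrite /q'; nra.
Qed.
End Overlap.

Section PiecewiseLinear.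
Local Open Scope complex_scope.
Variables (R : realType) (V : finType) (p : V -> R[i]).

(** The point of the simplex with weights a, b, c at i, j, k, as a sum of
    indicators: this makes sums over all vertices split by linearity. *)
Definition bary (i j k : V) (a b c : R) : 'rV[R]_#|V| :=
  \row_m (a *+ (enum_val m == i) + b *+ (enum_val m == j) + c *+ (enum_val m == k)).

Lemma baryE i j k a b c m : bary i j k a b c 0 (enum_rank m) =
  a *+ (m == i) + b *+ (m == j) + c *+ (m == k).
Proof. by rewrite mxE enum_rankK. Qed.

Lemma sum_mask (S : nmodType) (i : V) (f : V -> S) : \sum_m f m *+ (m == i) = f i.
Proof. by rewrite (bigD1 i) //= eqxx big1 ?addr0 // => m /negbTE ->. Qed.

Lemma pl_bary i j k a b c :
  pl p (bary i j k a b c) = a%:C * p i + b%:C * p j + c%:C * p k.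
Proof.
rewrite /pl -(sum_mask i (fun m => a%:C * p m)) -(sum_mask j (fun m => b%:C * p m)).
rewrite -(sum_mask k (fun m => c%:C * p m)) -!big_split /=; apply: eq_bigr => m _.
by rewrite baryE !rmorphD /= !rmorphMn /= !mulrDl !mulrnAl.
Qed.

Lemma bary_face i j k a b c : 0 <= a -> 0 <= b -> 0 <= c -> a + b + c = 1 ->
  face [set i; j; k] (bary i j k a b c).
Proof.
move=> a0 b0 c0 s1; split.
- by move=> m; rewrite baryE !addr_ge0 ?mulrn_wge0.
- move=> m; rewrite !inE baryE !negb_or -andbA => /and3P[].
  by do 3 move/negbTE ->; rewrite !addr0.
- under eq_bigr do rewrite baryE.
  by rewrite !big_split /= !sum_mask.
Qed.

(** Over the simplex of barycentric coordinates the signed area is affine in its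
    third vertex. *)
Lemma area2_pl (a b : R[i]) (x : 'rV[R]_#|V|) : \sum_i x 0 (enum_rank i) = 1 ->
  area2 a b (pl p x) = \sum_i x 0 (enum_rank i) * area2 a b (p i).
Proof.
move=> s1.
have E : pl p x - a = \sum_i (x 0 (enum_rank i))%:C * (p i - a).
  under eq_bigr do rewrite mulrBr.
  by rewrite sumrB -mulr_suml -rmorph_sum s1 mul1r.
rewrite /area2 E mulr_sumr raddf_sum; apply: eq_bigr => i _.
rewrite mulrCA; move: (_ * (p i - a)) => -[u w] /=; simpc => /=; ring.
Qed.

(** If l were on the side of k, the point of [same_side_overlap] would lie in
    both triangles but off the line through p i and p j, which contains the
    image of their common edge. *)
Lemma star_opposite (T : {set {set V}}) i j k l : star_embedded T p i ->
  [set i; j; k] \in T -> [set i; j; l] \in T -> k != l ->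
  k \notin [set i; j] ->
  0 < area2 (p i) (p j) (p k) -> ~~ (0 < area2 (p i) (p j) (p l)).
Proof.
move=> emb tT t'T kl kn ak; apply/negP => al.
have [[[[a b] c] [[a' b'] c']] [[a0 b0 c0 s1] [a'0 b'0 c'0 s1'] e]] :=
  same_side_overlap ak al.
have tt' : [set i; j; k] != [set i; j; l].
  apply/eqP => /setP /(_ k); rewrite !inE eqxx orbT.
  by move: kn; rewrite !inE => /negbTE ->; rewrite (negbTE kl).
have it m : i \in [set i; j; m] by rewrite !inE eqxx.
have [] := emb _ _ tT t'T (it k) (it l) tt' (pl p (bary i j k a b c)).
  split; first by exists (bary i j k a b c) => //; apply: bary_face => //; exact: ltW.
  exists (bary i j l a' b' c'); last by rewrite !pl_bary.
  by apply: bary_face => //; exact: ltW.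
move=> x [x0 xs xsum] /(congr1 (area2 (p i) (p j))).
rewrite !area2_pl //; last first.
  by have [] := @bary_face i j k a b c a0 b0 (ltW c0) s1.
have aii : area2 (p i) (p j) (p i) = 0 by rewrite area2E; ring.
have ajj : area2 (p i) (p j) (p j) = 0 by rewrite area2E; ring.
rewrite big1 => [|m _]; last first.
  have [->|mi] := eqVneq m i; first by rewrite aii mulr0.
  have [->|mj] := eqVneq m j; first by rewrite ajj mulr0.
  rewrite xs ?mul0r // !inE (negbTE mi) (negbTE mj) /=.
  by apply/negP => /andP[/eqP -> /eqP kl']; rewrite kl' eqxx in kl.
under eq_bigr do rewrite baryE !mulrDl !mulrnAl.
rewrite !big_split /= !sum_mask aii ajj !mulr0 !add0r => /esym/eqP.
by rewrite gt_eqF // mulr_gt0.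
Qed.
End PiecewiseLinear.

(** * Counterclockwise triangles *)

Section Ccw.
Variables (R : realType) (V : finType) (T : {set {set V}}) (v : V -> R[i]).

Lemma set3_rot (i j k : V) : [set j; k; i] = [set i; j; k].
Proof. by apply/setP => y; rewrite !inE; do 3 case: (y == _). Qed.

Lemma set3_swap (i j k : V) : [set j; i; k] = [set i; j; k].
Proof. by apply/setP => y; rewrite !inE; do 2 case: (y == _). Qed.

Lemma set3_swapr (i j k : V) : [set i; k; j] = [set i; j; k].
Proof. by apply/setP => y; rewrite !inE; do 3 case: (y == _). Qed.

Lemma area2aab (a b : R[i]) : area2 a a b = 0.
Proof. by rewrite /area2 subrr rmorph0 mul0r. Qed.

Lemma area2_swap (a b c : R[i]) : area2 b a c = - area2 a b c.
Proof. by rewrite !area2E; ring. Qed.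

Lemma area2_swapr (a b c : R[i]) : area2 a c b = - area2 a b c.
Proof. by rewrite !area2E; ring. Qed.

Lemma ccw_rot i j k : ccw_triangle T v i j k = ccw_triangle T v j k i.
Proof.
rewrite /ccw_triangle; congr (_ && _).
  by rewrite (set3_rot i j k).
by congr (_ < _); rewrite !area2E; ring.
Qed.

Lemma ccw_neq i j k : ccw_triangle T v i j k -> i != j.
Proof.
by case/andP=> _; apply: contraTneq => ->; rewrite area2aab ltxx.
Qed.

Lemma ccw_vneq i j k : ccw_triangle T v i j k -> v j - v i != 0.
Proof.
case/andP=> _; apply: contraTneq => /eqP; rewrite subr_eq0 => /eqP ->.
by rewrite area2aab ltxx.
Qed.

Lemma ccw_edge i j k : ccw_triangle T v i j k -> [set i; j] \in edges T.
Proof.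
move=> c; rewrite inE cards2 (ccw_neq c) eqxx /=; apply/existsP.
by exists [set i; j; k]; case/andP: c => -> _; rewrite finset.subsetUl.
Qed.

Lemma ccw_sides i j k : ccw_triangle T v i j k ->
  [/\ [set i; j] \in edges T, [set j; k] \in edges T, [set k; i] \in edges T &
  [/\ [set i; j] \subset [set i; j; k], [set j; k] \subset [set i; j; k] &
      [set k; i] \subset [set i; j; k]]].
Proof.
move=> c; have c2 := c; rewrite ccw_rot in c2; have c3 := c2; rewrite ccw_rot in c3.
split; [exact: ccw_edge c|exact: ccw_edge c2|exact: ccw_edge c3|].
by split; apply/fintype.subsetP => y; rewrite !inE => /orP[] ->; rewrite ?orbT.
Qed.

End Ccw.

(** * The closed 1-form of one triangle *)

Section OneTriangle.
Variables (R : realType) (V : finType) (T : {set {set V}}) (v : V -> R[i]).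
Local Open Scope complex_scope.

(** Let p and q be the differences of the first and of the second bracket with
    the third, in the first relation, and p' and q' those in the second one.
    Eliminating C gives A p = - B q and A p' = - B q', so p q' = p' q; the
    conclusion is the imaginary part of this equation. *)
Lemma closing_symmetric (A B C : R[i]) (m1 m2 m3 a1 a2 a3 n1 n2 n3 b1 b2 b3 : R) :
  A != 0 -> A + B + C = 0 ->
  A * (m1 +i* a1) + B * (m2 +i* a2) + C * (m3 +i* a3) = 0 ->
  A * (n1 +i* b1) + B * (n2 +i* b2) + C * (n3 +i* b3) = 0 ->
  (m2 - m3) * b1 + (m3 - m1) * b2 + (m1 - m2) * b3 =
  (n2 - n3) * a1 + (n3 - n1) * a2 + (n1 - n2) * a3.
Proof.
move=> A0 sum0.
set M1 := m1 +i* a1; set M2 := m2 +i* a2; set M3 := m3 +i* a3.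
set N1 := n1 +i* b1; set N2 := n2 +i* b2; set N3 := n3 +i* b3.
move=> dm dn.
have : (M1 - M3) * (N2 - N3) = (N1 - N3) * (M2 - M3).
  apply: (mulfI A0); apply/eqP; rewrite -subr_eq0; apply/eqP.
  have -> : A * ((M1 - M3) * (N2 - N3)) - A * ((N1 - N3) * (M2 - M3)) =
    (N2 - N3) * (A * M1 + B * M2 + C * M3)
    - (M2 - M3) * (A * N1 + B * N2 + C * N3)
    + (A + B + C) * (M2 * N3 - M3 * N2) by ring.
  by rewrite dm dn sum0 !mulr0 mul0r subr0 addr0.
rewrite /M1 /M2 /M3 /N1 /N2 /N3; simpc => -[_ im].
lra.
Qed.

Lemma entry_line e (x a : edge_space (R := R) T) (h : R) :
  entry (h *: a + x) e = h * entry a e + entry x e.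
Proof.
by rewrite /entry; case: insub => [e'|]; rewrite ?mxE // mulr0 addr0.
Qed.

Lemma is_derive_entry e (x a : edge_space (R := R) T) :
  is_derive (0 : R) 1 (fun h => entry (h *: a + x) e) (entry a e).
Proof.
rewrite (_ : (fun h => _) = fun h => h * entry a e + entry x e); last first.
  by apply/funext => h; rewrite entry_line.
by apply: is_derive_eq; rewrite /GRing.scale /=; ring.
Qed.

Variables (theta : R) (U : set (edge_space (R := R) T)).
Variable nu : {set V} -> {set V} -> edge_space (R := R) T -> R.
Hypothesis U_open : open U.
Hypothesis nu_smooth :
  forall t e, t \in T -> e \in edges T -> e \subset t -> smooth_on U (nu t e).
Hypothesis nu_closing : closing_condition v theta U nu.

Lemma nu_differentiable t e x :
  t \in T -> e \in edges T -> e \subset t -> U x -> differentiable (nu t e) x.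
Proof. by move=> tT eE et; have [H _] := nu_smooth tT eE et 1; apply: H. Qed.

(** The derivative of the closing condition in the direction a, divided by the
    common factor [Cexp (theta *i)]. *)
Lemma closing_derivative i j k x a : ccw_triangle T v i j k -> U x ->
  let t := [set i; j; k] in
  let A p q := (v q - v p) *
      twist theta (entry x [set p; q]) (nu t [set p; q] x) in
  let mu p q := 'D_a (nu t [set p; q]) x +i* entry a [set p; q] in
  A i j * mu i j + A j k * mu j k + A k i * mu k i = 0.
Proof.
move=> c Ux t A mu.
have tT : t \in T by case/andP: c.
pose S p q h := (v q - v p) *
   twist theta (entry (h *: a + x) [set p; q]) (nu t [set p; q] (h *: a + x)).
have DS p q : [set p; q] \in edges T -> [set p; q] \subset t ->
  let d := Cexp (theta *i) * (A p q * mu p q) in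
  is_derive (0:R) 1 (fun h => complex.Re (S p q h)) (complex.Re d) /\
  is_derive (0:R) 1 (fun h => complex.Im (S p q h)) (complex.Im d).
  move=> eE et.
  have Df := is_derive_line
    (diff_derivable (nu_differentiable tT eE et Ux)).
  have := is_derive_twist (v q - v p) theta (Df a)
    (is_derive_entry [set p; q] x a).
  by rewrite scale0r add0r.
have [e1 e2 e3 [s1 s2 s3]] := ccw_sides c.
have [R1 I1] := DS _ _ e1 s1.
have [R2 I2] := DS _ _ e2 s2.
have [R3 I3] := DS _ _ e3 s3.
have near0 : (\forall h \near (0 : R), S i j h + S j k h + S k i h = 0)%classic.
  have : (\forall h \near (0 : R), U (h *: a + x))%classic.
    have cl : continuous (fun h : R => h *: a + x).
      move=> h; apply: cvgD; last exact: cvg_cst.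
      by apply: cvgZr_tmp; exact: cvg_id.
    by apply: (cl 0); apply: open_nbhs_nbhs; split => //; rewrite scale0r add0r.
  by apply: filterS => h Uh; have := nu_closing Uh c.
apply: (mulfI (Cexp_neq0 (theta *i))); rewrite mulr0 !mulrDr.
apply/eqP; rewrite eq_complex; apply/andP; split; apply/eqP.
- rewrite !raddfD /=.
  apply: (is_derive_near0 (is_deriveD (is_deriveD R1 R2) R3)).
  by apply: filterS near0 => h /(congr1 (@complex.Re R)); rewrite !raddfD.
- rewrite !raddfD /=.
  apply: (is_derive_near0 (is_deriveD (is_deriveD I1 I2) I3)).
  by apply: filterS near0 => h /(congr1 (@complex.Im R)); rewrite !raddfD.
Qed.

(** The coefficient of d omega_ij in the form of the triangle (i, j, k). *)
Definition opp_coef (i j k : V) (x : edge_space (R := R) T) : R :=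
  nu [set i; j; k] [set j; k] x - nu [set i; j; k] [set k; i] x.

Lemma nu_diff_side i j k p q x : ccw_triangle T v i j k -> U x ->
  [set p; q] \in edges T -> [set p; q] \subset [set i; j; k] ->
  differentiable (nu [set i; j; k] [set p; q]) x.
Proof. by case/andP=> tT _ Ux eE et; exact: nu_differentiable. Qed.

Lemma opp_coef_diff i j k x : ccw_triangle T v i j k -> U x ->
  differentiable (opp_coef i j k) x.
Proof.
move=> c Ux; have [_ e2 e3 [_ s2 s3]] := ccw_sides c.
by apply: differentiableB; apply: (nu_diff_side c).
Qed.

Lemma derive_opp_coef i j k x a : ccw_triangle T v i j k -> U x ->
  'D_a (opp_coef i j k) x =
  'D_a (nu [set i; j; k] [set j; k]) x - 'D_a (nu [set i; j; k] [set k; i]) x.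
Proof.
move=> c Ux; have [_ e2 e3 [_ s2 s3]] := ccw_sides c.
by rewrite /opp_coef deriveB //; apply/diff_derivable/(nu_diff_side c).
Qed.

(** The closedness of the form of the triangle (i, j, k): this is
    [closing_symmetric] for A, B, C the sides of the triangle given by x. *)
Lemma triangle_closed i j k x a b : ccw_triangle T v i j k -> U x ->
  'D_a (opp_coef i j k) x * entry b [set i; j] +
  'D_a (opp_coef j k i) x * entry b [set j; k] +
  'D_a (opp_coef k i j) x * entry b [set k; i] =
  'D_b (opp_coef i j k) x * entry a [set i; j] +
  'D_b (opp_coef j k i) x * entry a [set j; k] +
  'D_b (opp_coef k i j) x * entry a [set k; i].
Proof.
move=> c Ux.
have c2 := c; rewrite ccw_rot in c2; have c3 := c2; rewrite ccw_rot in c3.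
rewrite !derive_opp_coef // -!(set3_rot k i j) !(set3_rot i j k).
apply: closing_symmetric (closing_derivative a c Ux) (closing_derivative b c Ux).
  by rewrite mulf_neq0 ?Cexp_neq0 ?(ccw_vneq c).
exact: nu_closing Ux _ _ _ c.
Qed.
End OneTriangle.

(** * The sum over the surface *)

Section Surface.
Variables (R : realType) (V : finType) (T : {set {set V}}) (v : V -> R[i]).
Hypothesis T_imm : immersed_triangulation T v.

Lemma triangle_third t i j : t \in T -> i != j -> [set i; j] \subset t ->
  exists2 k, t = [set i; j; k] & k \notin [set i; j].
Proof.
move=> tT ij et; have [card3 _ _ _ _] := T_imm.
have : #|t :\: [set i; j]| == 1%N.
  by rewrite cardsD (finset.setIidPr et) cards2 ij card3.
case/cards1P => k tk; exists k; last first.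
  by have : k \in t :\: [set i; j]; [rewrite tk inE|rewrite inE => /andP[]].
by rewrite -(finset.setID t [set i; j]) (finset.setIidPr et) tk.
Qed.

(** Without such labels [xi_coef] would be 0 by default: the choice in
    [edge_labels] succeeds because the two triangles at e are on different sides
    of it. *)
Lemma interior_edge_labels e : e \in interior_edges T -> exists i j k l,
  [&& e == [set i; j], ccw_triangle T v i j k & ccw_triangle T v i l j].
Proof.
rewrite inE => /andP[]; rewrite inE => /andP[/cards2P[i [j [ij ->]]] _].
case/cards2P => t [t' [tt' tri]].
have /andP[tT et] : (t \in T) && ([set i; j] \subset t).
  by have : t \in [set t; t']; [rewrite !inE eqxx|rewrite -tri inE].
have /andP[t'T et'] : (t' \in T) && ([set i; j] \subset t').
  by have : t' \in [set t; t']; [rewrite !inE eqxx orbT|rewrite -tri inE].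
have [k tk kn] := triangle_third tT ij et.
have [l t'l ln] := triangle_third t'T ij et'.
rewrite {}tk in tT tt' {tri et}; rewrite {}t'l in t'T tt' {et'}.
have kl : k != l by apply: contraNneq tt' => ->.
have [_ _ _ nondeg emb] := T_imm.
have nz m : [set i; j; m] \in T -> m \notin [set i; j] -> area2 (v i) (v j) (v m) != 0.
  move=> mT; rewrite !inE negb_or => /andP[mi mj].
  by apply: nondeg => //; rewrite eq_sym.
have swap m : [set i; j; m] \in T -> m \notin [set i; j] ->
    ~~ (0 < area2 (v i) (v j) (v m)) -> 0 < area2 (v j) (v i) (v m).
  move=> mT mn; rewrite -leNgt le_eqVlt (negbTE (nz _ mT mn)) /= => neg.
  by rewrite area2_swap oppr_gt0.
have pair m n : [set i; j; m] \in T -> m \notin [set i; j] ->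
    [set i; j; n] \in T -> n \notin [set i; j] -> m != n ->
    0 < area2 (v i) (v j) (v m) -> exists k l,
      ccw_triangle T v i j k && ccw_triangle T v i l j.
  move=> mT mn nT nn mn' am; exists m, n.
  rewrite /ccw_triangle mT am set3_swapr nT /= area2_swapr -area2_swap.
  exact: swap nT nn (star_opposite (emb i) mT nT mn' mn am).
suff [k' [l' kl']] : exists k l, ccw_triangle T v i j k && ccw_triangle T v i l j.
  by exists i, j, k', l'; rewrite eqxx.
have [ak|ak] := boolP (0 < area2 (v i) (v j) (v k)).
  exact: pair tT kn t'T ln kl ak.
have ajk := swap _ tT kn ak.
apply: (pair l k) => //; first by rewrite eq_sym.
have := @star_opposite _ _ v T j i k l (emb j).
rewrite !(set3_swap i j) (finset.setUC [set j]) => /(_ tT t'T kl kn ajk).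
rewrite area2_swap oppr_gt0 -leNgt le_eqVlt eq_sym.
by rewrite (negbTE (nz _ t'T ln)).
Qed.

Variable nu : {set V} -> {set V} -> edge_space (R := R) T -> R.

(** A triple (i, j, k) stands for the triangle with these vertices and its side
    [i, j], so a triangle occurs in sums over triples once for each side. *)
Definition ccw (q : V * V * V) := ccw_triangle T v q.1.1 q.1.2 q.2.
Definition base_edge (q : V * V * V) := [set q.1.1; q.1.2].
Definition coef (q : V * V * V) := opp_coef nu q.1.1 q.1.2 q.2.

(** With the labels i, j, k, l of e, the triples over e are (i, j, k) and
    (j, i, l): a third one would need a third triangle at e, or one of these two
    with the opposite orientation. *)
Lemma xi_coef_sum e x : e \in interior_edges T ->
  xi_coef v nu e x = \sum_(q | ccw q && (base_edge q == e)) coef q x.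
Proof.
move=> eI; rewrite /xi_coef /edge_labels.
case: pickP => [[[[i j] k] l]|none]; last first.
  have [i [j [k [l ok]]]] := interior_edge_labels eI.
  by have := none (i, j, k, l); rewrite /= ok.
case/and3P => /eqP ee c c'.
have ij := ccw_neq c.
have c1 : ccw_triangle T v j i l by move: c'; rewrite ccw_rot ccw_rot.
have kT : [set i; j; k] \in T by case/andP: c.
have lT : [set i; j; l] \in T by case/andP: c1; rewrite set3_swap.
have ak : 0 < area2 (v i) (v j) (v k) by case/andP: c.
have al : area2 (v i) (v j) (v l) < 0.
  by case/andP: c1 => _; rewrite area2_swap oppr_gt0.
have third i' j' m m' : i' != j' -> [set i'; j'; m] \in T ->
    [set i'; j'; m] = [set i'; j'; m'] -> m = m'.
  move=> ij' mT /setP /(_ m); rewrite !inE eqxx orbT => /esym/orP[|/eqP //].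
  rewrite -in_set2 => mij; have [card3 _ _ _ _] := T_imm; have := card3 _ mT.
  by rewrite (finset.setUidPl _) ?finset.sub1set // cards2 ij'.
have kl : k != l by apply: contraTneq ak => ->; rewrite -leNgt ltW.
have dist : [set i; j; k] != [set i; j; l].
  by apply: contra_neq kl => /third; apply.
have tri : [set t in T | e \subset t] = [set [set i; j; k]; [set i; j; l]].
  apply/esym/eqP; rewrite eqEcard; apply/andP; split.
    by rewrite finset.subUset !finset.sub1set !inE kT lT ee !finset.subsetUl.
  by move: eI; rewrite inE => /andP[_ /eqP ->]; rewrite cards2 dist.
rewrite (bigD1 (i, j, k)) /=; last by rewrite /ccw c /base_edge /= ee.
rewrite (bigD1 (j, i, l)) /=; last first.
  rewrite /ccw c1 /base_edge /= ee finset.setUC eqxx /=.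
  by apply: contraNneq kl => -[_ _ ->].
rewrite big1 => [|[[i' j'] m]]; last first.
  rewrite /ccw /base_edge /= => /andP[/andP[/andP[cm /eqP be] nk] nl].
  have mT : [set i'; j'; m] \in [set [set i; j; k]; [set i; j; l]].
    by rewrite -tri inE -be finset.subsetUl andbT; case/andP: cm.
  exfalso; have ij' := ccw_neq cm; have m3 : [set i'; j'; m] \in T by case/andP: cm.
  have am : 0 < area2 (v i') (v j') (v m) by case/andP: cm.
  have i'in : i' \in [set i; j] by rewrite -ee -be !inE eqxx.
  have j'in : j' \in [set i; j] by rewrite -ee -be !inE eqxx orbT.
  move: i'in j'in; rewrite !inE.
  case/orP => /eqP i'E; case/orP => /eqP j'E; subst i' j'; rewrite ?eqxx // in ij'.
    move: mT; rewrite !inE => /orP[] /eqP /third mE.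
      by move: nk; rewrite mE ?eqxx.
    by move: am; rewrite mE // ltNge ltW.
  rewrite -!(set3_swap i j) in mT.
  move: mT; rewrite !inE => /orP[] /eqP /third mE.
    by move: am; rewrite mE // area2_swap oppr_gt0 ltNge ltW.
  by move: nl; rewrite mE ?eqxx.
rewrite addr0 /coef /opp_coef /=.
by rewrite (set3_rot j i l); ring.
Qed.

Lemma Xi_sum_edges x b : Xi v nu x b = \sum_(e in interior_edges T)
  (\sum_(q | ccw q && (base_edge q == e)) coef q x) * entry b e.
Proof. by apply: eq_bigr => e eI; rewrite xi_coef_sum. Qed.

Lemma Xi_sum_corners x b : interior_directions b ->
  Xi v nu x b = \sum_(q | ccw q) coef q x * entry b (base_edge q).
Proof.
move=> bI; rewrite Xi_sum_edges.
rewrite [RHS](partition_big base_edge (mem (edges T))) /=; last first.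
  by move=> q; apply: ccw_edge.
rewrite [RHS](bigID (mem (interior_edges T))) /= [X in _ = _ + X]big1 => [|e]; last first.
  case/andP=> eE eI; rewrite big1 // => q /andP[_ /eqP ->].
  by rewrite bI ?mulr0.
rewrite addr0; apply: eq_big => [e|e _]; first by rewrite !inE andbA andbb.
by rewrite mulr_suml; apply: eq_bigr => q /andP[_ /eqP ->].
Qed.

Variables (theta : R) (U : set (edge_space (R := R) T)).
Hypothesis U_open : open U.
Hypothesis nu_smooth :
  forall t e, t \in T -> e \in edges T -> e \subset t -> smooth_on U (nu t e).
Hypothesis nu_closing : closing_condition v theta U nu.

Lemma Xi_differentiable x a : U x -> differentiable (fun y => Xi v nu y a) x.
Proof.
move=> Ux; under eq_fun do rewrite Xi_sum_edges.
apply: differentiable_bigsum => e eI; apply: differentiableM; last exact: differentiable_cst.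
apply: differentiable_bigsum => q /andP[cq _].
exact: (opp_coef_diff nu_smooth cq).
Qed.

Lemma derive_Xi x a b : U x -> interior_directions b ->
  'D_a (fun y => Xi v nu y b) x =
  \sum_(q | ccw q) 'D_a (coef q) x * entry b (base_edge q).
Proof.
move=> Ux bI; under eq_fun do rewrite Xi_sum_corners //.
apply: derive_val; apply: is_derive_bigsum => q cq.
have Dq : is_derive x a (coef q) ('D_a (coef q) x).
  by split=> //; apply: diff_derivable; apply: (opp_coef_diff nu_smooth cq).
by apply: is_derive_eq; rewrite scaler0 add0r /GRing.scale /= mulrC.
Qed.

Definition rot_corner (q : V * V * V) := (q.1.2, q.2, q.1.1).

Lemma sum_corner_rot (F : V * V * V -> R) :
  \sum_(q | ccw q) F q = \sum_(q | ccw q) F (rot_corner q).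
Proof.
rewrite (reindex_inj (h := rot_corner)) => [|[[i j] k] [[i' j'] k'] [-> -> ->] //].
by apply: eq_bigl => q; rewrite /ccw /= -ccw_rot.
Qed.

(** Grouping a sum over triples into triangles amounts to averaging it over the
    rotations of the triples; the factor 3 replaces the division. *)
Lemma Xi_closed : closed_along U (interior_directions (T := T)) (Xi v nu).
Proof.
move=> x Ux; split=> [a|a b aI bI]; first exact: Xi_differentiable.
rewrite !derive_Xi //.
pose F (c d : edge_space T) q := 'D_c (coef q) x * entry d (base_edge q).
have S3 (c d : edge_space T) : (\sum_(q | ccw q) F c d q) *+ 3 = \sum_(q | ccw q)
    (F c d q + F c d (rot_corner q) + F c d (rot_corner (rot_corner q))).
  rewrite !big_split /= -(sum_corner_rot (fun q => F c d (rot_corner q))).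
  by rewrite -sum_corner_rot !mulrS mulr0n addr0 addrA.
suff : (\sum_(q | ccw q) F a b q) *+ 3 = (\sum_(q | ccw q) F b a q) *+ 3.
  by move/eqP; rewrite eqrMn2r // => /eqP.
rewrite !S3; apply: eq_bigr => -[[i j] k] cq.
exact: (triangle_closed U_open nu_smooth nu_closing a b cq Ux).
Qed.
End Surface.

Theorem theorem5p3 (R : realType) (V : finType) (T : {set {set V}})
    (v : V -> R[i]) (theta : R)
    (T_imm : immersed_triangulation T v)
    (T_sc : simply_connected (realization (R := R) T))
    (theta_range : 0 <= theta <= pi / 2)
    (z : V -> R[i]) (omega0 nu0 : edge_space (R := R) T)
    (z_conf : theta_conformal T v theta z)
    (z_vars : edge_variables v theta z omega0 nu0)
    (U : set (edge_space (R := R) T)) (U_open : open U) (U_omega0 : U omega0)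
    (nu : {set V} -> {set V} -> edge_space (R := R) T -> R)
    (nu_dep : dependent_nu v theta U omega0 nu0 nu) :
  closed_along U (interior_directions (T := T)) (Xi v nu).
Proof.
have [nu_smooth _ nu_closing] := nu_dep.
exact: (Xi_closed T_imm U_open nu_smooth nu_closing).
Qed.
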